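(* Let $n \ge 1$, $d \ge 1$ be integers, let $\mathbb{H} \subset \mathbb{C}$ be a closed half-plane, and let $f_1,\dots,f_m \in \mathbb{C}[X_1,\dots,X_n]$ be symmetric polynomials of degree at most $d$. Then $$V(f_1,\dots,f_m) \cap \mathbb{H}^n = \emptyset \iff V(f_1,\dots,f_m) \cap \mathbb{H}_{2(d+2),\,d+2} = \emptyset.$$ Moreover, if $\mathbb{H}$ is a rotation of the upper half-plane, i.e. $\mathbb{H} = \{ e^{i\theta} w : w \in \mathbb{C}, \operatorname{Im}(w) \ge 0 \}$ for some $\theta \in \mathbb{R}$, then $$V(f_1,\dots,f_m) \cap \mathbb{H}^n = \emptyset \iff V(f_1,\dots,f_m) \cap \mathbb{H}_{d,d} = \emptyset.$$
   Context: $V(f_1,\dots,f_m) \subset \mathbb{C}^n$ denotes the common complex zero set of $f_1,\dots,f_m$. For a closed half-plane $\mathbb{H} \subset \mathbb{C}$ with boundary line $\operatorname{bd}\mathbb{H}$ and interior $\operatorname{int}\mathbb{H}$, and nonnegative integers $p,q$, define $$\mathbb{H}_{p,q} := \left\{ x \in \mathbb{H}^n : |\{x_1,\dots,x_n\} \cap \operatorname{bd}\mathbb{H}| \le p \text{ and } |\{ j \in \{1,\dots,n\} : x_j \in \operatorname{int}\mathbb{H} \}| \le q \right\}.$$ *)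

(* Defs.v *)
From mathcomp Require Import all_boot all_order all_algebra.
From mathcomp Require Import boolp classical_sets functions cardinality.
From mathcomp Require Import reals topology normedtype trigo complex.
(* The notations of [mpoly] have levels that conflict with those of
   [classical_sets] and [topology], hence the filtered import. *)
From mathcomp.multinomials Require Import -(notations) mpoly.

Set Implicit Arguments.
Unset Strict Implicit.
Unset Printing Implicit Defensive.

Import Order.TTheory GRing.Theory Num.Theory.
Import numFieldNormedType.Exports.

Local Open Scope classical_set_scope.
Local Open Scope complex_scope.
Local Open Scope card_scope.
Local Open Scope ring_scope.

(* [R[i]] carries its usual (modulus) topology through the alias [R[i]^o]. *)
Definition plane_interior (R : realType) (H : set R[i]) : set R[i] :=
  interior (H : set R[i]^o).

Definition plane_boundary (R : realType) (H : set R[i]) : set R[i] :=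
  closure (H : set R[i]^o) `\` interior (H : set R[i]^o).

(* [Re (a^* * z)] is the Euclidean scalar product of [a] and [z] in the plane:
   [a] is a normal vector of the boundary line, pointing into the half-plane. *)
Definition closed_half_plane (R : realType) (H : set R[i]) : Prop :=
  exists (a : R[i]) (c : R), a != 0 /\ H = [set z | c <= complex.Re (a^* * z)].

Definition upper_half_plane (R : realType) : set R[i] :=
  [set w | 0 <= complex.Im w].

Definition expi (R : realType) (theta : R) : R[i] := cos theta +i* sin theta.

Definition rotation (R : realType) (theta : R) (A : set R[i]) : set R[i] :=
  [set expi theta * w | w in A].

Definition zero_set (R : realType) (n m : nat)
    (f : 'I_m -> mpoly n R[i]) : set ('I_n -> R[i]) :=
  [set x | forall k, meval x (f k) = 0].

Definition cartesian_power (R : realType) (n : nat) (H : set R[i]) :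
    set ('I_n -> R[i]) :=
  [set x | forall j, H (x j)].

(* The first bound counts distinct values on the boundary, the second one counts
   indices, i.e. interior coordinates with multiplicity. *)
Definition half_plane_pq (R : realType) (n : nat) (H : set R[i]) (p q : nat) :
    set ('I_n -> R[i]) :=
  [set x | [/\ cartesian_power H x,
               range x `&` plane_boundary H #<= `I_p &
               [set j | plane_interior H (x j)] #<= `I_q]].

(* Main.v *)
(* The map [z |-> 'i * (a^* * z - c)] carries a closed half-plane onto the upper
   one. It respects the relation that the monic polynomials with roots [x] and
   [y] have the same [d] top coefficients after the leading one, so [H_{d,d}]
   suffices for every half-plane. A symmetric polynomial of degree at most [d] is
   a polynomial in the elementary symmetric functions [e_1, ..., e_d], hence
   constant on the classes of this relation. For [2 <= d] a class is compact in
   the closed upper half-plane, since [e_1] bounds the imaginary parts and then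
   [e_2] the real parts. Take a point of the class where the real part of the
   next coefficient is maximal. If it had [d + 1] interior roots, or [d + 1]
   distinct real roots, then the product [U] of the corresponding linear factors
   could be replaced by [U + e] for a small real [e > 0]: its roots stay in the
   half-plane (for distinct real roots, by sign changes), the class does not
   change and the next coefficient grows by [e]. *)

Require Import Defs.
From mathcomp Require Import all_boot all_order all_algebra.
From mathcomp Require Import boolp classical_sets functions cardinality.
From mathcomp Require Import reals topology normedtype trigo complex.
From mathcomp.multinomials Require Import -(notations) mpoly.
From mathcomp Require Import zify ring lra polyrcf derive.

Set Implicit Arguments.
Unset Strict Implicit.
Unset Printing Implicit Defensive.

Import Order.TTheory GRing.Theory Num.Theory.
Import numFieldNormedType.Exports.

Local Open Scope classical_set_scope.
Local Open Scope ring_scope.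

Local Notation prodX s := (\prod_(z <- s) ('X - z%:P)).

(** * Adding a small positive constant to a product of linear factors *)

(** Supplies the small constants below. Entries that are not positive are skipped, so a list of
    distances may contain the zeros [|a - a|]. *)
Lemma exists_pos_lt_seq (R : realFieldType) (s : seq R) :
  exists2 e, 0 < e & forall x, x \in s -> 0 < x -> e < x.
Proof.
elim: s => [|y s [e e0 es]]; first by exists 1.
have [y0|y0] := ltP 0 y; last first.
  exists e => // x; rewrite inE => /orP[/eqP->|/es//].
  by rewrite ltNge y0.
exists (Num.min e (y / 2)); first by rewrite lt_min e0 divr_gt0.
move=> x; rewrite inE gt_min => /orP[/eqP-> _|/es/[apply]->//].
by apply/orP; right; lra.
Qed.

(** With [r] less than half of every gap, the intervals [[a - r, a + r]] are disjoint and [P]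
    changes sign on each of them. If [e] is below all [|P.[a - r]|] and [|P.[a + r]|], then [P + e]
    has the same signs there, hence a root in each interval. These are as many distinct roots as the
    degree. *)
Lemma real_roots_shift (R : rcfType) (s : seq R) : s != [::] -> uniq s ->
  exists2 e : R, 0 < e &
  exists2 s' : seq R, size s' = size s & prodX s' = prodX s + e%:P.
Proof.
move=> s0 us; set P := prodX s.
have [r r0 rP] := exists_pos_lt_seq [seq `|a - b| / 2 | a <- s, b <- s].
have sep a b : a \in s -> b \in s -> a != b -> r < `|a - b| / 2.
  move=> sa sb ab; apply: rP; first by apply/allpairsP; exists (a, b).
  by rewrite divr_gt0// normr_gt0 subr_eq0.
(* [P.[a - r] * P.[a + r]] is the product of the [(a - b) ^+ 2 - r ^+ 2], in
   which only the factor [b = a] is negative. *)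
have P_sign a : a \in s -> P.[a - r] * P.[a + r] < 0.
  move=> sa; rewrite !horner_prod -big_split/= (big_rem a)//= !hornerE.
  rewrite pmulr_llt0; first by nra.
  rewrite big_seq; apply: prodr_gt0 => b; rewrite mem_rem_uniq// inE => /andP[ba sb].
  rewrite !hornerE; have := sep _ _ sa sb; rewrite eq_sym ba => /(_ isT) h.
  have : r ^+ 2 < `|a - b| ^+ 2 by rewrite ltr_pXn2r ?nnegrE ?normr_ge0 ?ltW//; lra.
  by rewrite real_normK ?num_real//; nra.
have [e e0 eP] := exists_pos_lt_seq
  ([seq `|P.[a - r]| | a <- s] ++ [seq `|P.[a + r]| | a <- s]).
(* Membership in [s] stands under the existential so that [choice] yields a total function; outside
   [s] the value 0 is a dummy. *)
have exroot a : exists t, a \in s -> a - r <= t <= a + r /\ root (P + e%:P) t.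
  have [sa|] := boolP (a \in s); last by exists 0.
  have /poly_ivtoo : a - r <= a + r by lra.
  move=> /(_ (P + e%:P)); rewrite !hornerE.
  have Pa := P_sign _ sa.
  have Pm0 : P.[a - r] != 0 by apply: contraTneq Pa => ->; rewrite mul0r ltxx.
  have Pp0 : P.[a + r] != 0 by apply: contraTneq Pa => ->; rewrite mulr0 ltxx.
  have em : e < `|P.[a - r]|.
    by apply: eP; rewrite ?normr_gt0// mem_cat (map_f (fun a => `|P.[a - r]|)).
  have ep : e < `|P.[a + r]|.
    apply: eP; rewrite ?normr_gt0// mem_cat.
    by rewrite orbC (map_f (fun a => `|P.[a + r]|)).
  case=> [|t]; last first.
    by rewrite inE/= => /andP[/ltW ta /ltW at']; exists t; rewrite ta at'.
  move: em ep Pa; set u := P.[a - r]; set v := P.[a + r] => em ep uv.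
  have [u0|u0] := leP 0 u.
    have v0 : v < 0 by nra.
    by rewrite (ger0_norm u0) (ltr0_norm v0) in em ep; nra.
  have v0 : 0 < v by nra.
  by rewrite (ltr0_norm u0) (gtr0_norm v0) in em ep; nra.
have [g gP] := choice exroot.
exists e => //; exists (map g s); first by rewrite size_map.
have szP : size P = (size s).+1 by rewrite size_prod_XsubC.
have sze : (size e%:P < size P)%N.
  by rewrite szP (leq_ltn_trans (size_polyC_leq1 _))// ltnS lt0n size_eq0.
rewrite [RHS](@all_roots_prod_XsubC _ _ (map g s)).
- by rewrite lead_coefDl// (monicP (monic_prod_XsubC _ _ _)) scale1r.
- by rewrite size_polyDl// szP size_map.
- by apply/allP => _ /mapP[a /gP[_ ?] ->].
rewrite uniq_rootsE map_inj_in_uniq// => a b sa sb gab.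
apply/eqP; apply: contraT => ab; have := sep _ _ sa sb ab.
have [[ga _] [gb _]] := (gP _ sa, gP _ sb).
by case: (ger0P (a - b)) => ? ?; move: ga gb;
  rewrite gab => /andP[? ?] /andP[? ?]; lra.
Qed.

Lemma complex_real_roots_shift (R : rcfType) (s : seq R[i]) :
  s != [::] -> uniq s -> all (fun z => complex.Im z == 0) s ->
  exists2 e : R, 0 < e & exists s' : seq R[i],
  [/\ size s' = size s, all (fun z => 0 <= complex.Im z) s'
    & prodX s' = prodX s + (e%:C)%C%:P].
Proof.
move=> s0 us s_re.
have sE : s = [seq (x%:C)%C | x <- [seq complex.Re z | z <- s]].
  rewrite -map_comp -[LHS]map_id; apply/eq_in_map => z /(allP s_re)/=.
  by case: z => x y /= /eqP->.
have [||e e0 [s' ss' s'E]] := @real_roots_shift R [seq complex.Re z | z <- s].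
- by rewrite -size_eq0 size_map size_eq0.
- by rewrite -(map_inj_uniq (@complexI R)) -sE.
exists e => //; exists [seq (x%:C)%C | x <- s']; split.
- by rewrite size_map ss' size_map.
- by apply/allP => _ /mapP[x _ ->].
have toC t : prodX [seq (x%:C)%C | x <- t] = map_poly (real_complex R) (prodX t).
  by rewrite big_map rmorph_prod; apply: eq_bigr => x _;
    rewrite rmorphB/= map_polyX map_polyC.
by rewrite toC s'E rmorphD/= -toC -sE map_polyC.
Qed.

(** If [Im z < 0], each factor satisfies [|z - w| >= Im w], so [|P.[z]|] is at least the product [d]
    of the imaginary parts. A shift by [d / 2] therefore creates no root in the open lower
    half-plane. *)
Lemma complex_upper_roots_shift (R : rcfType) (s : seq R[i]) :
  s != [::] -> all (fun z => 0 < complex.Im z) s ->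
  exists2 e : R, 0 < e & exists s' : seq R[i],
  [/\ size s' = size s, all (fun z => 0 <= complex.Im z) s'
    & prodX s' = prodX s + (e%:C)%C%:P].
Proof.
move=> s0 s_up; pose d := \prod_(z <- s) complex.Im z.
have d0 : 0 < d.
  by rewrite /d big_seq; apply: prodr_gt0 => z /(allP s_up).
exists (d / 2); first by rewrite divr_gt0.
set e : R[i] := ((d / 2)%:C)%C.
set P := prodX s.
have szP : size P = (size s).+1 by rewrite size_prod_XsubC.
have sze : (size e%:P < size P)%N.
  by rewrite szP (leq_ltn_trans (size_polyC_leq1 _))// ltnS lt0n size_eq0.
have [r rP] := closed_field_poly_normal (P + e%:P).
have PE : prodX r = P + e%:P.
  by rewrite rP lead_coefDl// (monicP (monic_prod_XsubC _ _ _)) scale1r.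
exists r; split => //.
  have := congr1 (size : {poly _} -> _) PE.
  by rewrite size_prod_XsubC size_polyDl// szP => -[].
apply/allP => z rz; rewrite leNgt; apply/negP => zlow.
have : root (P + e%:P) z by rewrite -PE root_prod_XsubC.
rewrite rootE !hornerE addr_eq0 horner_prod => /eqP/(congr1 Num.norm).
rewrite normrN normr_prod.
have -> : `|e| = e by rewrite ger0_norm// lecR ltW// divr_gt0.
have : (d%:C)%C <= \prod_(i <- s) `|('X - i%:P).[z]|.
  rewrite rmorph_prod/= !big_seq; apply: ler_prod => w ws.
  have w0 := allP s_up _ ws; rewrite lecR (ltW w0)/= !hornerE.
  rewrite normc_def lecR -(ger0_norm (ltW w0)) -sqrtr_sqr; apply: ler_wsqrtr.
  case: z w zlow w0 {rz ws} => [zx zy] [wx wy]/= zlow w0.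
  have : zy * wy < 0 by rewrite nmulr_rlt0.
  by have := sqr_ge0 (zx - wx); have := sqr_ge0 zy; nra.
by move=> /[swap] ->; rewrite lecR; lra.
Qed.

(** * Compactness of a class of root lists and a maximizer in it *)

(** Newton's identity [p_2 = e_1 ^ 2 - 2 e_2]: the coefficients of index [n.+1] and [n] are [- e_1]
    and [e_2]. *)
Lemma sum_sqr_prod_XsubC (A : comNzRingType) (s : seq A) n : size s = n.+2 ->
  \sum_(z <- s) z ^+ 2 = (prodX s)`_n.+1 ^+ 2 - (prodX s)`_n *+ 2.
Proof.
move=> ss; set P := prodX s.
(* The factor ['X^2] makes the identities meaningful for every size of [s]. *)
suff [_ [Q1 Q2]] : [/\ (P * 'X^2)`_(size s).+2 = 1,
    (P * 'X^2)`_(size s).+1 = - \sum_(z <- s) z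
  & (P * 'X^2)`_(size s) *+ 2 = (\sum_(z <- s) z) ^+ 2 - \sum_(z <- s) z ^+ 2].
  by move: Q1 Q2; rewrite ss !coefMXn/= !subSS !subn0 => -> ->; ring.
rewrite {}/P; elim: s {n ss} => [|c s [Q0 Q1 Q2]].
  by rewrite !big_nil mul1r !coefXn/= expr0n subrr mul0rn oppr0.
rewrite !big_cons -mulrA mulrBl !coefB ![('X * _)`_ _]coefXM !coefCM/=.
set Q := prodX s * 'X^2 in Q0 Q1 Q2 *.
have Q3 : Q`_(size s).+3 = 0.
  apply: nth_default; rewrite size_Mmonic ?monicXn ?size_polyXn//.
    by rewrite size_prod_XsubC !addnS addn0/= .
  exact/monic_neq0/monic_prod_XsubC.
rewrite Q0 Q1 Q3; split; [by rewrite mulr0 subr0| by ring|].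
by rewrite mulrnBl Q2; ring.
Qed.

(** Split into components because closedness and the extreme value theorem are applied to
    real-valued functions. *)
Definition complex_continuous (R : realType) (T : topologicalType) (g : T -> R[i]) :=
  continuous (fun v => complex.Re (g v)) /\ continuous (fun v => complex.Im (g v)).

Lemma complex_continuous_coef_prod_XsubC (R : realType) (T : topologicalType)
    (I : Type) (g : I -> T -> R[i]) (r : seq I) (k : nat) :
  (forall i, complex_continuous (g i)) ->
  complex_continuous (fun v => (\prod_(i <- r) ('X - (g i v)%:P))`_k).
Proof.
move=> cg; elim: r k => [|i r IH] k.
  split; under [X in continuous X]eq_fun => v do rewrite big_nil;
  exact: cst_continuous.
have [cR cI] := IH k; have [gR gI] := cg i.
have [cR' cI'] : complex_continuous (fun v => if k is k'.+1 then
    (\prod_(i <- r) ('X - (g i v)%:P))`_k' else 0).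
  by case: k {cR cI} => [|k]; [split; exact: cst_continuous|exact: IH].
have E v : (\prod_(i <- i :: r) ('X - (g i v)%:P))`_k =
    (if k is k'.+1 then (\prod_(i <- r) ('X - (g i v)%:P))`_k' else 0) -
    g i v * (\prod_(i <- r) ('X - (g i v)%:P))`_k.
  by rewrite big_cons mulrBl coefB coefXM coefCM; case: k {cR cI cR' cI'}.
have ReM (z w : R[i]) : complex.Re (z * w) =
    complex.Re z * complex.Re w - complex.Im z * complex.Im w.
  by case: z w => ? ? [].
have ImM (z w : R[i]) : complex.Im (z * w) =
    complex.Re z * complex.Im w + complex.Im z * complex.Re w.
  by case: z w => ? ? [].
split; under [X in continuous X]eq_fun => v do rewrite E raddfB/= ?ReM ?ImM.
  by move=> v; apply: cvgB; [exact: cR'|apply: cvgB; apply: cvgM;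
    [exact: gR|exact: cR|exact: gI|exact: cI]].
by move=> v; apply: cvgB; [exact: cI'|apply: cvgD; apply: cvgM;
  [exact: gR|exact: cI|exact: gI|exact: cR]].
Qed.

(** The size bound on a difference says that the coefficients of index at least [n - d] agree: the
    leading one and the next [d]. Root lists become vectors of length [n + n], real parts first, and
    the extreme value theorem applies to the real part of the coefficient of index [n - d - 1]. *)
Lemma upper_roots_argmax (R : realType) (s0 : seq R[i]) (d : nat) :
  (2 <= d)%N -> (d < size s0)%N -> all (fun z => 0 <= complex.Im z) s0 ->
  exists s : seq R[i],
    [/\ size s = size s0, all (fun z => 0 <= complex.Im z) s,
        (size (prodX s - prodX s0)%R <= size s0 - d)%N
      & forall s' : seq R[i], size s' = size s0 ->
          all (fun z => 0 <= complex.Im z) s' ->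
          (size (prodX s' - prodX s0)%R <= size s0 - d)%N ->
          complex.Re (prodX s')`_(size s0 - d).-1
            <= complex.Re (prodX s)`_(size s0 - d).-1].
Proof.
move=> d2; set n := size s0 => dn s0_up.
pose z (i : 'I_n) (v : 'rV[R]_(n + n)) : R[i] :=
  Complex (v ord0 (lshift n i)) (v ord0 (rshift n i)).
pose zs v := [seq z i v | i <- enum 'I_n].
have szs v : size (zs v) = n by rewrite size_map size_enum_ord.
have cz i : complex_continuous (z i) by split; exact: coord_continuous.
have zs_surj (s : seq R[i]) : size s = n -> exists v, zs v = s.
  move=> ss; exists (row_mx (\row_i complex.Re (nth 0 s i))
                            (\row_i complex.Im (nth 0 s i))).
  apply: (@eq_from_nth _ 0); first by rewrite szs.
  move=> i; rewrite szs => ilt; rewrite (nth_map (Ordinal ilt)) ?size_enum_ord//.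
  rewrite /z row_mxEl row_mxEr !mxE nth_enum_ord//.
  by case: nth.
pose F k v := (prodX (zs v))`_k.
have cF k : complex_continuous (F k).
  have -> : F k = fun v => (\prod_(i <- enum 'I_n) ('X - (z i v)%:P))`_k.
    by apply/funext => v; rewrite /F big_map.
  exact: complex_continuous_coef_prod_XsubC.
pose K : set 'rV[R]_(n + n) := [set v : 'rV[R]_(n + n) |
  (forall i, 0 <= v ord0 (rshift n i)) /\
  forall k, (n - d <= k)%N -> F k v = (prodX s0)`_k].
have KE v : K v <-> all (fun z => 0 <= complex.Im z) (zs v) /\
    (size (prodX (zs v) - prodX s0)%R <= n - d)%N.
  split=> -[h1 h2]; split.
  - by apply/allP => _ /mapP[i _ ->]; exact: h1.
  - by apply/leq_sizeP => k /h2; rewrite coefB /F => ->; rewrite subrr.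
  - by move=> i; apply: (allP h1 (z i v)); apply/mapP; exists i; rewrite ?mem_enum.
  - move=> k dk; apply/eqP; rewrite -subr_eq0 -coefB; apply/eqP.
    by move/leq_sizeP: h2; apply.
have K0 : K !=set0.
  have [v vs0] := zs_surj s0 erefl; exists v; apply/KE.
  by rewrite vs0 subrr size_poly0.
have Kclosed : closed K.
  have -> : K = \bigcap_(i in [set: 'I_n])
      ((fun v : 'rV[R]_(n + n) => v ord0 (rshift n i)) @^-1` [set x | 0 <= x])
    `&` \bigcap_(k in [set k | (n - d <= k)%N])
      (((fun v => complex.Re (F k v)) @^-1` [set x | x = complex.Re (prodX s0)`_k])
       `&` ((fun v => complex.Im (F k v)) @^-1`
          [set x | x = complex.Im (prodX s0)`_k])).
    apply/seteqP; split=> v /= -[h1 h2]; split=> k.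
    - by move=> _; exact: h1.
    - by move=> /h2 /= ->.
    - exact: h1.
    - by move=> /h2[/=]; case: (F k v) ((prodX s0)`_k) => ? ? [? ?] /= -> ->.
  apply: closedI; apply: closed_bigI => k _; last apply: closedI.
  - by apply: closed_comp; [move=> v _; exact: coord_continuous|exact: closed_ge].
  - by apply: closed_comp; [move=> v _; exact: (cF k).1|exact: closed_eq].
  - by apply: closed_comp; [move=> v _; exact: (cF k).2|exact: closed_eq].
have [B Bbound] : exists B : R, forall v j, K v -> `|v ord0 j| <= B.
  (* The imaginary parts are nonnegative with sum [B1], so each is at most [B1]. Since
     [Re (z ^ 2) = x ^ 2 - y ^ 2], the sum of the [x ^ 2] is at most [C]; finally
     [|x| <= x ^ 2 + 1 <= C + 1]. *)
  pose B1 := complex.Im (\sum_(c <- s0) c).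
  pose C := complex.Re (\sum_(c <- s0) c ^+ 2) + (B1 ^+ 2) *+ n.
  exists (B1 + C + 1) => v j [h1 h2].
  have n0 : n = n.-2.+2 by lia.
  have S1 : \sum_(i < n) z i v = \sum_(c <- s0) c.
    have sz0 (s : seq R[i]) : size s = n -> size s != 0 by move=> ->; rewrite n0.
    apply: oppr_inj; rewrite -coefPn_prod_XsubC ?sz0// -(h2 n.-1); last by lia.
    rewrite /F -[in RHS](szs v) coefPn_prod_XsubC ?sz0//.
    by rewrite big_map big_enum.
  have S2 : \sum_(i < n) z i v ^+ 2 = \sum_(c <- s0) c ^+ 2.
    rewrite (@sum_sqr_prod_XsubC _ s0 n.-2)// -(h2 n.-2.+1) -1?(h2 n.-2); [|lia..].
    by rewrite -sum_sqr_prod_XsubC ?szs// big_map big_enum.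
  have Im_le i : v ord0 (rshift n i) <= B1.
    rewrite /B1 -S1 raddf_sum/= (bigD1 i)//= lerDl.
    by apply: sumr_ge0 => k _; exact: h1.
  have C_ge : \sum_(i < n) v ord0 (lshift n i) ^+ 2 <= C.
    rewrite /C -S2 raddf_sum/= -lerBlDl -sumrB.
    rewrite -[in leRHS](card_ord n) -sumr_const ler_sum// => i _.
    have := Im_le i; have := h1 i; rewrite expr2 /=; nra.
  have Re_le i : v ord0 (lshift n i) ^+ 2 <= C.
    apply: le_trans C_ge; rewrite (bigD1 i)//= lerDl.
    by apply: sumr_ge0 => k _; exact: sqr_ge0.
  rewrite ler_norml; case: (split_ordP j) => i ->;
  have := Re_le i; have := h1 i; have := Im_le i;
  by move=> *; apply/andP; split; nra.
have Kcompact : compact K.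
  have box := @rV_compact R (n + n) (fun=> `[- B, B]%classic)
    (fun=> @segment_compact R (- B) B).
  apply: (subclosed_compact Kclosed box) => v Kv i /=.
  by rewrite in_itv/= -ler_norml; exact: Bbound.
have [v /set_mem/KE[v_up vs] vmax] := @EVT_max_rV R _ _ _ K0 Kcompact
  (continuous_subspaceT (cF (n - d).-1).1).
exists (zs v); split=> // s' /zs_surj[w <-] w_up ws.
by apply: vmax; apply/mem_set/KE.
Qed.

(** * Root lists with few interior and few distinct real roots *)

Lemma upper_roots_few (R : realType) (s0 : seq R[i]) (d : nat) :
  (1 <= d)%N -> all (fun z => 0 <= complex.Im z) s0 ->
  exists s : seq R[i],
    [/\ size s = size s0, all (fun z => 0 <= complex.Im z) s,
        (size (prodX s - prodX s0)%R <= size s0 - d)%N,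
        (count (fun z => 0 < complex.Im z)%R s <= d)%N
      & (size (undup [seq z <- s | complex.Im z == 0%R]) <= d)%N].
Proof.
move=> d1 s0_up; have [s0d|ds0] := leqP (size s0) d.
  exists s0; split=> //.
  - by rewrite subrr size_poly0.
  - exact: leq_trans (count_size _ _) s0d.
  - by rewrite (leq_trans (size_undup _))// size_filter (leq_trans (count_size _ _)).
(* For [d = 1] the class is not compact. *)
have [dE|d2] : d = 1%N \/ (2 <= d)%N by lia.
  subst d; pose n := size s0; pose c := \sum_(z <- s0) z.
  have c_up : 0 <= complex.Im c.
    by rewrite /c big_seq raddf_sum sumr_ge0// => z /(allP s0_up).
  have undup_nseq m (x : R[i]) : (size (undup (nseq m x)) <= 1)%N.
    apply: (@uniq_leq_size _ _ [:: x]); rewrite ?undup_uniq// => y.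
    by rewrite mem_undup mem_nseq inE => /andP[].
  have same_sum s : size s = n -> \sum_(z <- s) z = c ->
      (size (prodX s - prodX s0)%R <= n - 1)%N.
    move=> sn sc; apply/leq_sizeP => k; rewrite coefB leq_eqVlt => /orP[/eqP<-|nk].
      have s00 : size s0 != 0 by rewrite -lt0n (ltn_trans _ ds0).
      rewrite subn1 -[in X in X - _]sn !coefPn_prod_XsubC ?sn//.
      by rewrite sc subrr.
    have [<-|nk'] : n = k \/ (n < k)%N by lia.
      have lead1 (s' : seq R[i]) : size s' = n -> (prodX s')`_n = 1.
        move=> <-; have := monic_prod_XsubC s' xpredT id.
        by rewrite monicE lead_coefE size_prod_XsubC => /eqP.
      by rewrite !lead1 ?subrr.
    by rewrite !nth_default ?subrr// size_prod_XsubC// sn.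
  (* Only the sum [c] has to be kept. If [c] is real, [n] copies of [c / n] have a single real
     value; otherwise [c] is the one interior root and 0 the only possible real one. *)
  have [c0|c0] := eqVneq (complex.Im c) 0.
    have n0 : n%:R != 0 :> R[i] by rewrite pnatr_eq0; lia.
    have Imcn : complex.Im (c / n%:R) = 0.
      have -> : c / n%:R = ((complex.Re c / n%:R)%:C)%C.
        rewrite rmorphM fmorphV rmorph_nat; congr (_ / _).
        by case: (c) c0 => ? ? /= ->.
      by [].
    exists (nseq n (c / n%:R)); split.
    - by rewrite size_nseq.
    - by rewrite all_nseq Imcn lexx orbT.
    - apply: same_sum; first by rewrite size_nseq.
      by rewrite big_nseq iter_addr_0 -[LHS]mulr_natr divfK.
    - by rewrite count_nseq Imcn ltxx.
    - by rewrite filter_nseq Imcn eqxx mul1n undup_nseq.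
  exists (c :: nseq n.-1 0); split.
  - by rewrite /= size_nseq /n; lia.
  - by rewrite /= c_up all_nseq lexx orbT.
  - apply: same_sum; first by rewrite /= size_nseq /n; lia.
    by rewrite big_cons big_nseq iter_addr_0 mul0rn addr0.
  - by rewrite /= count_nseq ltxx mul0n addn0; case: (_ < _).
  - by rewrite /= (negbTE c0) filter_nseq eqxx mul1n undup_nseq.
have [s [sn s_up ss0 smax]] := upper_roots_argmax d2 ds0 s0_up.
(* The remaining roots [u] number [n - d - 1]. Replacing [t] by [t'] adds [e * prodX u], which
   leaves the coefficients from [n - d] on unchanged and raises the next one by [e], against
   maximality. *)
have stuck (t : seq R[i]) : subseq t s -> size t = d.+1 ->
    ~ exists2 e : R, 0 < e & exists t' : seq R[i],
      [/\ size t' = size t, all (fun z => 0 <= complex.Im z) t'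
        & prodX t' = prodX t + (e%:C)%C%:P].
  move=> /perm_to_subseq[u sE] td [e e0 [t' [tt' t'_up t'E]]].
  have ud : size u = (size s0 - d).-1.
    by have := perm_size sE; rewrite size_cat sn td; lia.
  have catE : prodX (t' ++ u) = prodX s + e%:C%C *: prodX u.
    by rewrite (perm_big _ sE) !big_cat/= t'E mulrDl mul_polyC.
  have := smax (t' ++ u); rewrite catE => smax_t.
  suff : complex.Re (prodX s + e%:C%C *: prodX u)`_(size s0 - d).-1
           <= complex.Re (prodX s)`_(size s0 - d).-1.
    rewrite coefD coefZ -ud; have := monic_prod_XsubC u xpredT id.
    rewrite monicE lead_coefE size_prod_XsubC/= => /eqP ->.
    by rewrite mulr1 raddfD/= gerDl leNgt e0.
  apply: smax_t.
  - by rewrite size_cat tt' -sn (perm_size sE) size_cat.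
  - rewrite all_cat t'_up/=; move: s_up.
    by rewrite (perm_all _ sE) all_cat => /andP[].
  - rewrite addrAC (leq_trans (size_polyD _ _))// geq_max ss0/=.
    rewrite (leq_trans (size_scale_leq _ _))// size_prod_XsubC ud; lia.
exists s; split=> //; rewrite leqNgt; apply/negP => bad.
  pose t := take d.+1 [seq z <- s | 0 < complex.Im z].
  have ts : subseq t s := subseq_trans (take_subseq _ _) (filter_subseq _ _).
  have td : size t = d.+1 by rewrite size_takel// size_filter.
  apply: (stuck _ ts td); apply: complex_upper_roots_shift.
    by rewrite -size_eq0 td.
  by apply/allP => z /mem_take; rewrite mem_filter => /andP[].
pose t := take d.+1 (undup [seq z <- s | complex.Im z == 0]).
have ts : subseq t s.
  apply: subseq_trans (subseq_trans (take_subseq _ _) (undup_subseq _)) _.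
  exact: filter_subseq.
have td : size t = d.+1 by rewrite size_takel.
apply: (stuck _ ts td); apply: complex_real_roots_shift.
- by rewrite -size_eq0 td.
- by rewrite take_uniq// undup_uniq.
- by apply/allP => z /mem_take; rewrite mem_undup mem_filter => /andP[].
Qed.

(** * Symmetric polynomials as functions of the top coefficients *)

Lemma symmetric_meval_eq (A : idomainType) (n d : nat) (p : mpoly n A)
    (s t : n.-tuple A) :
  p \is @symmetric n A -> (msize p <= d.+1)%N ->
  (size (prodX s - prodX t)%R <= n - d)%N ->
  meval (tnth s) p = meval (tnth t) p.
Proof.
move=> p_sym pd /leq_sizeP st.
have e_eq (k : 'I_n) : (k < d)%N ->
    meval (tnth s) (mesym n A k.+1) = meval (tnth t) (mesym n A k.+1).
  move=> kd; have kn : (k.+1 < n.+1)%N by rewrite ltnS.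
  have /eqP := st (n - k.+1)%N (leq_sub2l _ kd).
  rewrite coefB subr_eq0 !(mroots_coeff _ (Ordinal kn))/= => /eqP.
  by apply: mulfI; rewrite signr_eq0.
have [q [qE qp]] := sym_fundamental p_sym.
rewrite -qE !comp_mpoly_meval !mevalE !big_seq; apply: eq_bigr => m qm.
congr (_ * _); apply: eq_bigr => i _; rewrite !tnth_map !tnth_ord_tuple.
have [->|mi0] := eqVneq (m i) 0%N; first by rewrite !expr0.
rewrite e_eq//.
(* Variable [i] of [q] stands for [e_(i+1)] and has weight [i.+1]. The weight of [m] is at most [d],
   so a variable that occurs in [m] satisfies [i < d]. *)
have := leq_trans (mmeasure_mnm_lt _ qm) (leq_trans qp pd).
rewrite ltnS /= /mnmwgt (bigD1 i)//= => /(leq_trans (leq_addr _ _)).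
by apply: leq_trans; rewrite leq_pmull// lt0n.
Qed.

(** * From the upper half-plane to an arbitrary closed half-plane *)

Lemma card_le_seq (T : choiceType) (A : set T) (s : seq T) (k : nat) :
  (size s <= k)%N -> (forall x, A x -> x \in s) -> (A #<= `I_k)%card.
Proof.
move=> sk As; apply/pcard_leP/injfunPex; exists (index^~ s).
  by move=> x /As xs /=; rewrite (leq_trans _ sk)// index_mem.
move=> x y /set_mem/As xs /set_mem/As ys xy.
by rewrite -(nth_index x xs) xy nth_index.
Qed.

Lemma near_Re_mul (R : realType) (b z : R[i]) (e : R) : 0 < e ->
  nbhs (z : R[i]^o) [set w | `|complex.Re (b * (w - z))| < e].
Proof.
(* The [+ 1] keeps the radius meaningful when [b = 0]. *)
move=> e0; apply/nbhs_ballP; exists ((e%:C)%C / (`|b| + 1)).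
  by rewrite /= divr_gt0 ?ltcR// ltr_wpDl.
move=> w /=; rewrite -ball_normE/= ltr_pdivlMr ?ltr_wpDl// => zw.
rewrite -ltcR (le_lt_trans (normc_ge_Re _))// normrM distrC mulrC.
by apply: le_lt_trans zw; rewrite ler_wpM2l// lerDl.
Qed.

Lemma plane_interior_half_plane (R : realType) (a : R[i]) (c : R) : a != 0 ->
  plane_interior [set z | c <= complex.Re (a^* * z)] `<=`
  [set z | c < complex.Re (a^* * z)].
Proof.
move=> a0 z /nbhs_ballP[e /= e0 eH].
have na0 : 0 < `|a| by rewrite normr_gt0.
(* A move of length [e / 2] against the normal [a] stays in the ball, hence in the half-plane, and
   strictly lowers [Re (a^* * z)]. *)
have t0 : 0 < e / (`|a| *+ 2) by rewrite divr_gt0// pmulrn_rgt0.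
have /eH : ball (z : R[i]^o) e (z - e / (`|a| *+ 2) * a).
  rewrite -ball_normE/= opprB addrC subrK normrM gtr0_norm//.
  rewrite -mulr_natr invfM mulrA mulrAC divfK ?gt_eqF//.
  by rewrite ltr_pdivrMr// ltr_pMr// ltr1n.
rewrite /= mulrBr raddfB/= lerBrDr; apply: lt_le_trans; rewrite ltrDl.
have : 0 < a^* * (e / (`|a| *+ 2) * a).
  by rewrite mulrCA [a^* * a]mulrC -normCK mulr_gt0// exprn_gt0.
by rewrite ltcE => /andP[].
Qed.

(** Both strict inequalities are open conditions: one puts [z] in the interior, the other outside
    the closure. *)
Lemma plane_boundary_half_plane (R : realType) (a : R[i]) (c : R) :
  plane_boundary [set z | c <= complex.Re (a^* * z)] `<=`
  [set z | complex.Re (a^* * z) = c].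
Proof.
move=> z [Hz nHz]; apply/eqP; rewrite eq_le; apply/andP; split.
  rewrite leNgt; apply/negP => z_gt; apply: nHz.
  have := @near_Re_mul R a^* z (complex.Re (a^* * z) - c).
  rewrite subr_gt0 => /(_ z_gt); apply: filterS => w /=.
  by rewrite mulrBr raddfB/= ltr_norml => /andP[+ _]; rewrite /=; lra.
rewrite leNgt; apply/negP => z_lt.
have := @near_Re_mul R a^* z (c - complex.Re (a^* * z)).
rewrite subr_gt0 => /(_ z_lt)/Hz[w [/=]].
by rewrite mulrBr raddfB/= ltr_norml => + /andP[_ +]; lra.
Qed.

Lemma half_plane_pq_witness (R : realType) (n d : nat) (a : R[i]) (c : R)
    (x : 'I_n -> R[i]) :
  (1 <= d)%N -> a != 0 ->
  let H := [set z | c <= complex.Re (a^* * z)] in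
  cartesian_power H x ->
  exists2 y : 'I_n -> R[i], half_plane_pq H d d y &
    (size (\prod_(j < n) ('X - (y j)%:P) - \prod_(j < n) ('X - (x j)%:P))%R
       <= n - d)%N.
Proof.
move=> d1 a0 H Hx; pose u : R[i] := Complex 0 1 * a^*.
pose v : R[i] := Complex 0 (- c).
have ImE z : complex.Im (u * z + v) = complex.Re (a^* * z) - c.
  by rewrite /u /v -mulrA; case: (a^* * z) => p q /=; rewrite !mul0r mul1r add0r.
have u0 : u != 0.
  by rewrite mulf_neq0 ?conjC_eq0// eq_complex/= oner_eq0 andbF.
pose g w := (w - v) / u.
have gK w : u * g w + v = w by rewrite mulrC divfK// subrK.
have Im_g w : complex.Re (a^* * g w) = complex.Im w + c.
  by have := ImE (g w); rewrite gK => ->; rewrite subrK.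
pose s0 := [seq u * x j + v | j <- enum 'I_n].
have s0n : size s0 = n by rewrite size_map size_enum_ord.
have [|s [sn s_up ss0 s_int s_bd]] := @upper_roots_few R s0 d d1.
  by apply/allP => _ /mapP[j _ ->]; rewrite ImE subr_ge0; exact: Hx.
rewrite s0n in sn ss0.
pose y (j : 'I_n) := g (nth 0 s j).
have sy : s = [seq u * y j + v | j <- enum 'I_n].
  apply: (@eq_from_nth _ 0); first by rewrite size_map size_enum_ord.
  move=> j; rewrite sn => jn; rewrite (nth_map (Ordinal jn)) ?size_enum_ord//.
  by rewrite gK nth_enum_ord.
exists y; first split.
- move=> j; rewrite /H/= Im_g lerDr; apply: (allP s_up).
  by rewrite mem_nth// sn.
- apply: (@card_le_seq _ _ (map g (undup [seq z <- s | complex.Im z == 0]))).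
    by rewrite size_map.
  move=> z [[j _ <-]] /plane_boundary_half_plane/=; rewrite Im_g => /eqP.
  rewrite -subr_eq0 addrK => yj; rewrite (map_f g)// mem_undup mem_filter yj/=.
  by rewrite mem_nth// sn.
- apply: (@card_le_seq _ _
    [seq j <- enum 'I_n | 0 < complex.Im (nth 0 s (j : 'I_n))]).
    apply: leq_trans s_int; rewrite size_filter.
    rewrite -(count_map (fun j : 'I_n => nth 0 s j) (fun z => 0 < complex.Im z)).
    apply: eq_leq; congr count; rewrite [RHS]sy; apply: eq_map => j /=.
    by rewrite gK.
  move=> j /(plane_interior_half_plane a0)/=; rewrite Im_g ltrDr => yj.
  by rewrite mem_filter yj mem_enum.
(* Substituting [u *: 'X + v] turns each factor into [u] times ['X - t j]. Composition with a
   polynomial of degree 1 preserves sizes, so the bound for the images of the roots carries back to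
   the roots. *)
have compE (t : 'I_n -> R[i]) : (prodX [seq u * t j + v | j <- enum 'I_n])
    \Po (u *: 'X + v%:P) = u ^+ n *: \prod_(j < n) ('X - (t j)%:P).
  rewrite big_map big_enum/= rmorph_prod/= -[in u ^+ n](card_ord n) -prodr_const.
  rewrite -scaler_prod; apply: eq_big => // j _.
  rewrite comp_polyB comp_polyX comp_polyC polyCD polyCM opprD addrACA subrr addr0.
  by rewrite scalerBr -[u *: (t j)%:P]mul_polyC.
rewrite -(size_scale _ (expf_neq0 n u0)) scalerBr -!compE -comp_polyB.
rewrite size_comp_poly2 -?sy//.
by rewrite -mul_polyC size_MXaddC polyC_eq0 (negbTE u0) size_polyC u0.
Qed.

(** * Common zeros of symmetric polynomials in a half-plane *)

Theorem theorem2p7 (R : realType) (n d m : nat) (n_ge1 : (1 <= n)%N)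
  (d_ge1 : (1 <= d)%N) (H : set R[i]) (halfH : closed_half_plane H)
  (f : 'I_m -> mpoly n R[i])
  (f_sym : forall k, f k \is @symmetric n R[i])
  (f_deg : forall k, (msize (f k) <= d.+1)%N) :
  (zero_set f `&` @cartesian_power R n H = set0 <->
   zero_set f `&` @half_plane_pq R n H (2 * (d + 2)) (d + 2) = set0)
  /\
  ((exists theta : R, H = rotation theta (@upper_half_plane R)) ->
   (zero_set f `&` @cartesian_power R n H = set0 <->
    zero_set f `&` @half_plane_pq R n H d d = set0)).
Proof.
have [a [c [a0 HE]]] := halfH.
(* Both equivalences are instances of this one, as [H_{d,d}] is contained in [H_{p,q}]. *)
have key p q : (d <= p)%N -> (d <= q)%N ->
    zero_set f `&` @cartesian_power R n H = set0 <->
    zero_set f `&` @half_plane_pq R n H p q = set0.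
  move=> dp dq; rewrite HE; split=> fH0; rewrite -subset0 => x [fx Hx].
    by rewrite -fH0; split=> //; case: Hx.
  have [y [Hy ybd yint] yx] := half_plane_pq_witness d_ge1 a0 Hx.
  suff : set0 y by []. rewrite -fH0; split; last first.
    split=> //.
      by apply: card_le_trans ybd _; rewrite card_le_II.
    by apply: card_le_trans yint _; rewrite card_le_II.
  move=> k; rewrite -(fx k).
  have tup (w : 'I_n -> R[i]) : tnth [tuple w j | j < n] =1 w.
    by move=> j; rewrite tnth_mktuple.
  have prodE (w : 'I_n -> R[i]) :
      prodX [tuple w j | j < n] = \prod_(j < n) ('X - (w j)%:P).
    by rewrite big_tuple; apply: eq_bigr => j _; rewrite tup.
  rewrite -(meval_eq _ (tup y)) -(meval_eq _ (tup x)).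
  by apply: (symmetric_meval_eq (f_sym k) (f_deg k)); rewrite !prodE.
split=> [|_]; apply: key; lia.
Qed.
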